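(* Let $A^\ast(n)$ be the number of three-colored partitions in $\Gamma$ that sum to a non-negative integer $n$ and contain no occurrences of any of $1_R$, $2_R$, and $1_B$. Then, as formal power series in $q$, $$\sum_{n \ge 0} A^\ast(n) q^n = \frac{1}{\left(q;q^2\right)_\infty\left(q^2,q^3;q^5\right)_\infty}.$$
   Context: A partition of $n$ is a finite non-increasing sequence of positive integers (called parts) that sums to $n$ (the empty partition is the unique partition of $0$). A three-colored partition is a partition in which each part is assigned one of three colors $R$, $G$, $B$; parts that are the same integer but have different colors are considered distinct. A part of size $j$ is written $j_R$, $j_G$ or $j_B$ according to its color, and its contribution to the sum is $j$. The order of the parts is immaterial (a colored partition is a finite multiset of colored parts). $\Gamma$ is the set of three-colored partitions (colors $R$, $G$, $B$) satisfying the following conditions: (i) The sizes of all parts are distinct: for every $j\ge 1$, there is at most one part in total among all copies of $j_R$, $j_G$, $j_B$. (ii) For every $j\ge 1$, none of the following pairs of parts occur together in the partition: $j_R$ and $(j+1)_R$; $j_R$ and $(j+2)_R$; $j_R$ and $(j+1)_B$; $j_G$ and $(j+1)_R$; $j_G$ and $(j+2)_R$; $j_G$ and $(j+1)_B$; $j_B$ and $(j+1)_R$; $j_B$ and $(j+1)_G$. Here $q$ is a formal variable, $(a;q)_\infty = \prod_{j=1}^{\infty}(1-aq^{j-1})$, and $(a_1,\dots,a_k;q)_\infty=(a_1;q)_\infty\cdots(a_k;q)_\infty$. Thus $(q;q^2)_\infty=\prod_{m\ge0}(1-q^{2m+1})$ and $(q^2,q^3;q^5)_\infty=\prod_{m\ge0}(1-q^{5m+2})(1-q^{5m+3})$.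 *)

(* Defs.v *)
From HB Require Import structures.
From mathcomp Require Import all_boot all_order all_algebra.
From mathcomp Require Import finmap multiset.
From mathcomp Require Import boolp classical_sets functions cardinality.

Set Implicit Arguments.
Unset Strict Implicit.
Unset Printing Implicit Defensive.

Import GRing.Theory.
Local Open Scope fset_scope.
Local Open Scope mset_scope.
Local Open Scope nat_scope.

Inductive color := Red | Green | Blue.

Definition color_code (c : color) : option bool :=
  match c with Red => None | Green => Some true | Blue => Some false end.
Definition color_decode (o : option bool) : color :=
  match o with None => Red | Some true => Green | Some false => Blue end.
Lemma color_codeK : cancel color_code color_decode.
Proof. by case. Qed.
HB.instance Definition _ := Finite.copy color (can_type color_codeK).

(* The part j_c is the pair (j, c). *)
Notation part := (nat * color)%type.

Definition colored_partition (p : {mset part}) : Prop :=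
  forall x : part, x \in p -> 0 < x.1.

(* The sum runs over the parts counted with multiplicity. *)
Definition weight (p : {mset part}) : nat := \sum_(x <- p) x.1.

(* (c, k, d) stands for the forbidden pairs j_c, (j + k)_d with j >= 1. *)
Definition forbidden : seq (color * nat * color) :=
  [:: (Red, 1, Red); (Red, 2, Red); (Red, 1, Blue);
      (Green, 1, Red); (Green, 2, Red); (Green, 1, Blue);
      (Blue, 1, Red); (Blue, 1, Green)].

Definition in_Gamma (p : {mset part}) : Prop :=
  [/\ colored_partition p,
      forall j : nat, 0 < j -> p (j, Red) + p (j, Green) + p (j, Blue) <= 1
    & forall (j : nat) (c : color) (k : nat) (d : color),
        0 < j -> (c, k, d) \in forbidden ->
        ~ ((j, c) \in p /\ (j + k, d) \in p)].

Definition Astar_set (n : nat) : set {mset part} :=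
  [set p | [/\ in_Gamma p, weight p = n, (1, Red) \notin p,
               (2, Red) \notin p & (1, Blue) \notin p]]%classic.

(* [fset_set] is junk (empty) on infinite sets: see [finite_Astar_set]. *)
Definition Astar (n : nat) : nat := #|` fset_set (Astar_set n)|.

Lemma mset_leq_weight (p : {mset part}) (x : part) :
  p x * x.1 <= weight p.
Proof.
rewrite -count_mem_mset /weight -sum1_count big_distrl /=.
rewrite [leqRHS](bigID (pred1 x)) /= (leq_trans _ (leq_addr _ _)) //.
by apply: leq_sum => y /eqP ->; rewrite mul1n.
Qed.

Lemma finite_weight (n : nat) : finite_set
  [set p : {mset part} | colored_partition p /\ weight p = n]%classic.
Proof.
pose code (p : {mset part}) : {ffun 'I_n.+1 * color -> 'I_n.+1} :=
  [ffun x : 'I_n.+1 * color => inord (p (val x.1, x.2))].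
have code_inj : {in [set p | colored_partition p /\ weight p = n]%classic &,
    injective code}.
  move=> p p'; rewrite !inE /= => -[pp wp] [pp' wp'] /ffunP e.
  have small r : colored_partition r -> weight r = n ->
      forall x, r x <= n /\ (n < x.1 -> r x = 0).
    move=> rr wr x; have := mset_leq_weight r x; rewrite wr => le.
    have [-> //|nz] := eqVneq (r x) 0.
    have x0 : 0 < x.1 by apply: rr; rewrite in_mset lt0n.
    split; first exact: leq_trans (leq_pmulr _ x0) le.
    move=> lt; have : r x * x.1 < x.1 by exact: leq_ltn_trans le lt.
    by rewrite ltnNge leq_pmull // lt0n.
  apply/msetP => -[j c].
  have [a1 a2] := small _ pp wp (j, c); have [b1 b2] := small _ pp' wp' (j, c).
  case: (ltnP n j) => [lt|le]; first by rewrite a2 // b2.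
  have /(congr1 val) := e (Ordinal (le : j < n.+1), c).
  by rewrite !ffunE /= !inordK.
have [g gK] : exists g, {in [set p | colored_partition p /\ weight p = n]%classic,
    cancel code g}.
  exists (fun c => xget mset0
    [set p | (colored_partition p /\ weight p = n) /\ code p = c]%classic).
  move=> p pP; case: xgetP => [p' _ [p'P e]|/(_ p) []]; last first.
    by split=> //; move: pP; rewrite inE.
  by apply: code_inj; rewrite ?inE //; move: pP; rewrite inE.
apply: (@sub_finite_set _ _ (g @` setT)%classic); last exact: finite_image.
by move=> p pP; exists (code p) => //; apply: gK; rewrite inE.
Qed.

Lemma finite_Astar_set (n : nat) : finite_set (Astar_set n).
Proof. by apply: sub_finite_set (finite_weight n) => p [[]]. Qed.

Local Open Scope ring_scope.

Record fps (R : Type) := Fps { fps_coef :> nat -> R }.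
Arguments Fps {R}.

Lemma fps_coefK (R : Type) : cancel (@fps_coef R) Fps.
Proof. by case. Qed.

Lemma fpsP (R : Type) (f g : fps R) : (forall n, f n = g n) -> f = g.
Proof. by case: f g => f [g] /= /funext ->. Qed.

HB.instance Definition _ (R : choiceType) :=
  Choice.copy (fps R) (can_type (@fps_coefK R)).

(* These operations are locked to keep unification from unfolding them. *)
HB.lock Definition fps_one (R : comNzRingType) : fps R :=
  Fps (fun n => (n == 0%N)%:R).

HB.lock Definition fps_mul (R : comNzRingType) (f g : fps R) : fps R :=
  Fps (fun n => \sum_(i < n.+1) f i * g (n - i)%N).

(* Coefficientwise limit: a coefficient that is not eventually constant gets
   the junk value 0. *)
HB.lock Definition fps_lim (R : comNzRingType) (u : nat -> fps R) : fps R :=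
  Fps (fun n => xget 0
    [set c : R | exists N0, forall N, (N0 <= N)%N -> u N n = c]%classic).

Section FpsRing.
Variable R : comNzRingType.
Implicit Types f g h : fps R.

Definition fps_zero : fps R := Fps (fun=> 0).
Definition fps_opp f : fps R := Fps (fun n => - f n).
Definition fps_add f g : fps R := Fps (fun n => f n + g n).

Fact fps_addA : associative fps_add.
Proof. by move=> f g h; apply: fpsP => n /=; rewrite addrA. Qed.
Fact fps_addC : commutative fps_add.
Proof. by move=> f g; apply: fpsP => n /=; rewrite addrC. Qed.
Fact fps_add0 : left_id fps_zero fps_add.
Proof. by move=> f; apply: fpsP => n /=; rewrite add0r. Qed.
Fact fps_addN : left_inverse fps_zero fps_opp fps_add.
Proof. by move=> f; apply: fpsP => n /=; rewrite addNr. Qed.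

HB.instance Definition _ :=
  GRing.isZmodule.Build (fps R) fps_addA fps_addC fps_add0 fps_addN.

Definition fps_trunc N f : {poly R} := \poly_(i < N) f i.

Lemma fps_mul_poly (p q : {poly R}) N f g : (forall i, (i < N)%N -> p`_i = f i) ->
  (forall i, (i < N)%N -> q`_i = g i) ->
  forall i, (i < N)%N -> (p * q)`_i = fps_mul f g i.
Proof.
move=> pf qg i iN; rewrite coefM fps_mul.unlock /=; apply: eq_bigr => j _.
by rewrite pf ?qg // (leq_ltn_trans _ iN) // ?leq_subr // -ltnS.
Qed.

Lemma fps_truncE N f i : (i < N)%N -> (fps_trunc N f)`_i = f i.
Proof. by rewrite coef_poly => ->. Qed.

Fact fps_mulA : associative (@fps_mul R).
Proof.
move=> f g h; apply: fpsP => n; have t := @fps_truncE n.+1.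
rewrite -(fps_mul_poly (t f) (fps_mul_poly (t g) (t h)) (leqnn _)) mulrA.
exact: (fps_mul_poly (fps_mul_poly (t f) (t g)) (t h) (leqnn _)).
Qed.
Fact fps_mulC : commutative (@fps_mul R).
Proof.
move=> f g; apply: fpsP => n; have t := @fps_truncE n.+1.
rewrite -(fps_mul_poly (t f) (t g) (leqnn _)) mulrC.
exact: (fps_mul_poly (t g) (t f) (leqnn _)).
Qed.
Fact fps_mul1 : left_id (fps_one R) (@fps_mul R).
Proof.
move=> f; rewrite fps_mul.unlock fps_one.unlock.
apply: fpsP => n /=; rewrite big_ord_recl /= mul1r subn0.
by rewrite big1 ?addr0 // => i _; rewrite mul0r.
Qed.
Fact fps_mulDl : left_distributive (@fps_mul R) +%R.
Proof.
move=> f g h; rewrite fps_mul.unlock.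
apply: fpsP => n /=; rewrite -big_split /=.
by apply: eq_bigr => i _; rewrite mulrDl.
Qed.
Fact fps_1neq0 : fps_one R != 0.
Proof.
by rewrite fps_one.unlock; apply/eqP => /(congr1 (fun f : fps R => f 0%N)) /= /eqP; rewrite oner_eq0.
Qed.

HB.instance Definition _ := GRing.Zmodule_isComNzRing.Build (fps R)
  fps_mulA fps_mulC fps_mul1 fps_mulDl fps_1neq0.

Lemma fps_coef0 n : (0 : fps R) n = 0. Proof. by []. Qed.
Lemma fps_coef1 n : (1 : fps R) n = (n == 0%N)%:R.
Proof. by rewrite -[1]/(fps_one R) fps_one.unlock. Qed.
Lemma fps_coefD f g n : (f + g) n = f n + g n. Proof. by []. Qed.
Lemma fps_coefN f n : (- f) n = - f n. Proof. by []. Qed.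
Lemma fps_coefM f g n : (f * g) n = \sum_(i < n.+1) f i * g (n - i)%N.
Proof. by rewrite -[f * g]/(fps_mul f g) fps_mul.unlock. Qed.

(* The variable q of the power series ring. *)
Definition fps_q : fps R := Fps (fun n => (n == 1%N)%:R).

Definition fps_cvg (u : nat -> fps R) (f : fps R) : Prop :=
  forall n, exists N0, forall N, (N0 <= N)%N -> u N n = f n.

Lemma fps_lim_eq u f : fps_cvg u f -> fps_lim u = f.
Proof.
move=> uf; rewrite fps_lim.unlock; apply: fpsP => n /=; case: (uf n) => N fN.
apply: xget_unique; first by exists N.
move=> c [N' cN'].
by rewrite -(fN (maxn N N')) ?leq_maxl // cN' // leq_maxr.
Qed.

End FpsRing.

Arguments fps_q {R}.

(* (a; q)_oo; the parameters are themselves power series, such as q ^+ 2. *)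
HB.lock Definition qpoch (R : comNzRingType) (a q : fps R) : fps R :=
  fps_lim (fun N => \prod_(j < N) (1 - a * q ^+ j)).

(* (a_1, ..., a_k; q)_oo *)
Definition qpochs (R : comNzRingType) (s : seq (fps R)) (q : fps R) : fps R :=
  \prod_(a <- s) qpoch a q.

Section QPochhammer.
Variable R : comNzRingType.
Implicit Types f : fps R.

Lemma fps_coef_expr0 f : f 0%N = 0 -> forall j n, (n < j)%N -> (f ^+ j) n = 0.
Proof.
move=> f0; elim=> [//|j IHj] n nj; rewrite exprS fps_coefM big_ord_recl f0 mul0r.
rewrite add0r big1 // => i _; rewrite IHj ?mulr0 //=.
rewrite /bump /= add1n (@leq_trans n) // ltn_subrL /=.
by rewrite (leq_ltn_trans _ (ltn_ord i)).
Qed.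

Lemma qpoch_cvg (a q : fps R) : q 0%N = 0 ->
  fps_cvg (fun N => \prod_(j < N) (1 - a * q ^+ j)) (qpoch a q).
Proof.
move=> q0; set u := fun N : nat => _.
suff cvg : fps_cvg u (Fps (fun n => u n.+1 n)) by rewrite qpoch.unlock (fps_lim_eq cvg).
move=> n; exists n.+1 => N; rewrite -[Fps _ n]/(u n.+1 n).
elim: N => [//|N IHN]; rewrite leq_eqVlt => /orP[/eqP <- //|nN].
have -> : u N.+1 = u N - u N * a * q ^+ N.
  by rewrite /u big_ord_recr /= mulrBr mulr1 mulrA.
rewrite -IHN // fps_coefD fps_coefN fps_coefM big1 ?subr0 // => i _.
by rewrite fps_coef_expr0 ?mulr0 // (leq_ltn_trans (leq_subr _ _)).
Qed.

Lemma qpoch_coef0 (a q : fps R) : a 0%N = 0 -> q 0%N = 0 -> qpoch a q 0%N = 1.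
Proof.
move=> a0 q0; have [N /(_ N (leqnn _)) <-] := qpoch_cvg a q0 0%N.
elim: N => [|N IHN]; first by rewrite big_ord0 fps_coef1.
rewrite big_ord_recr fps_coefM big_ord1 IHN mul1r.
by rewrite fps_coefD fps_coefN fps_coefM big_ord1 a0 mul0r subr0 fps_coef1.
Qed.

End QPochhammer.

Definition fps_unit (R : comUnitRingType) : pred (fps R) :=
  fun f => f 0%N \is a GRing.unit.

Fixpoint fps_inv_seq (R : comUnitRingType) (f : fps R) (n : nat) : seq R :=
  if n is m.+1 then
    let s := fps_inv_seq f m in
    rcons s (- (f 0%N)^-1 * \sum_(i < m.+1) f i.+1 * s`_(m - i))
  else [:: (f 0%N)^-1].

(* Rings with units require non-units to be their own inverse. *)
HB.lock Definition fps_inv (R : comUnitRingType) (f : fps R) : fps R :=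
  if fps_unit f then Fps (fun n => (fps_inv_seq f n)`_n) else f.

Section FpsUnitRing.
Variable R : comUnitRingType.
Implicit Types f g : fps R.

Lemma size_fps_inv_seq f n : size (fps_inv_seq f n) = n.+1.
Proof. by elim: n => //= n IHn; rewrite size_rcons IHn. Qed.

Lemma nth_fps_inv_seq f n i : (i <= n)%N ->
  (fps_inv_seq f n)`_i = (fps_inv_seq f i)`_i.
Proof.
elim: n => [|n IHn]; first by rewrite leqn0 => /eqP ->.
rewrite leq_eqVlt => /orP[/eqP -> //|lt].
by rewrite /= nth_rcons size_fps_inv_seq lt IHn.
Qed.

Fact fps_mulVr : {in @fps_unit R, left_inverse 1 (@fps_inv R) *%R}.
Proof.
move=> f uf; have uf0 : f 0%N \is a GRing.unit by exact: uf.
rewrite mulrC fps_inv.unlock [fps_unit f]uf; apply: fpsP => n.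
rewrite fps_coefM fps_coef1 big_ord_recl subn0 /=.
case: n => [|n]; first by rewrite big_ord0 addr0 mulrV.
rewrite /= nth_rcons size_fps_inv_seq ltnn eqxx mulrA mulrN mulrV // mulN1r.
apply/eqP; rewrite addrC subr_eq0; apply/eqP; apply: eq_bigr => i _.
by rewrite /bump /= add1n subSS [in RHS]nth_fps_inv_seq ?leq_subr.
Qed.

Fact fps_unitP f g : g * f = 1 -> fps_unit f.
Proof.
move=> /(congr1 (fun h : fps R => h 0%N)); rewrite fps_coefM fps_coef1 big_ord1 => e.
by apply/unitrPr; exists (g 0%N); rewrite mulrC.
Qed.

Fact fps_inv0id : {in [predC @fps_unit R], @fps_inv R =1 id}.
Proof. by move=> f nf; rewrite fps_inv.unlock; case: ifP => // uf; case/negP: nf. Qed.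

HB.instance Definition _ := GRing.ComNzRing_hasMulInverse.Build (fps R)
  fps_mulVr fps_unitP fps_inv0id.

Lemma fps_unitE f : (f \is a GRing.unit) = (f 0%N \is a GRing.unit).
Proof. by []. Qed.

Lemma qpoch_unit (a q : fps R) : a 0%N = 0 -> q 0%N = 0 ->
  qpoch a q \is a GRing.unit.
Proof. by move=> a0 q0; rewrite fps_unitE qpoch_coef0 ?unitr1. Qed.

End FpsUnitRing.

Definition gen_series (a : nat -> nat) : fps int := Fps (fun n => (a n)%:Z).

(* Main.v *)
Require Import Defs.
From mathcomp Require Import all_boot all_order all_algebra.
From mathcomp Require Import finmap multiset.
From mathcomp Require Import boolp classical_sets cardinality.
From mathcomp Require Import ring zify.

(* Listed by increasing size, a partition of Gamma is a word in the colors with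
   a minimal gap between neighbours that depends only on the two colors. The
   partitions with n parts counted by A* thus have the generating function
   q^C(n+1,2) p_n / (q)_n, where the minimal gaps give
     p_(n+2) = (1 + q + q^(2n+4)) p_(n+1) - q (1 - q^(2n+2)) p_n,
   whence p_n = (q)_n (-q)_n g_n with g_n = sum_k q^(k^2+k) / ((q^2;q^2)_k (q)_(n-k)).
   The sum over n of q^C(n+1,2) (-q)_n g_n is then evaluated by Bailey's lemma at
   a = q: the unit Bailey pair yields successively beta_n = 1/(q^2;q^2)_n,
   beta_n = g_n, and the sum itself, which equals
     (-q)_oo / (q)_oo * sum_r (-1)^r q^((5r^2+3r)/2) (1 - q^(2r+1)),
   and the Jacobi triple product in base q^5 concludes. All identities are proved
   in finite form; the limit is taken by truncation. *)

Set Implicit Arguments.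
Unset Strict Implicit.
Unset Printing Implicit Defensive.

Import GRing.Theory.
Local Open Scope mset_scope.
Local Open Scope ring_scope.

(** * Gaussian binomials and the q-Vandermonde sum *)

Section FiniteProducts.
Variable A : comNzRingType.
Implicit Types a q B C D : A.

Definition qprod a q n : A := \prod_(i < n) (1 - a * q ^+ i).

Lemma qprod0 a q : qprod a q 0 = 1.
Proof. exact: big_ord0. Qed.

Lemma qprodS a q n : qprod a q n.+1 = qprod a q n * (1 - a * q ^+ n).
Proof. exact: big_ord_recr. Qed.

Fixpoint qbinom q n k : A :=
  match n, k with
  | _, 0 => 1
  | 0, _.+1 => 0
  | n'.+1, k'.+1 => qbinom q n' k'.+1 + q ^+ (n' - k') * qbinom q n' k'
  end.

Lemma qbinom0 q n : qbinom q n 0 = 1.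
Proof. by case: n. Qed.

Lemma qbinomS q n k :
  qbinom q n.+1 k.+1 = qbinom q n k.+1 + q ^+ (n - k) * qbinom q n k.
Proof. by []. Qed.

Lemma qbinom_small q n k : (n < k)%N -> qbinom q n k = 0.
Proof.
elim: n k => [|n IHn] [|k] //; rewrite ltnS => nk.
by rewrite qbinomS !IHn ?mulr0 ?addr0 // ltnW.
Qed.

(** Induction on [m + k]. In the step to [m.+1] and [k.+1] the two Pascal terms contribute 1 -
    q^(m+1) and q^(m+1) (1 - q^(k+1)), which add up to 1 - q^(m+k+2). *)
Lemma qbinom_qprod q m k :
  qbinom q (m + k) k * qprod q q k * qprod q q m = qprod q q (m + k).
Proof.
have nn n : qbinom q n n = 1.
  by elim: n => // n IHn; rewrite qbinomS qbinom_small // subnn IHn add0r mulr1.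
have [n] := ubnP (m + k)%N; elim: n => // n IHn in m k *.
case: k => [|k]; first by rewrite addn0 qbinom0 qprod0 !mul1r.
case: m => [|m]; first by rewrite add0n nn qprod0 mulr1 mul1r.
rewrite addSn addnS !ltnS => le; rewrite qbinomS.
have := IHn m k.+1; rewrite addnS => /(_ le) e1.
have := IHn m.+1 k; rewrite addSn => /(_ le) e2.
have -> : ((m + k).+1 - k = m.+1)%N by lia.
rewrite mulrDl mulrDl [X in X + _ = _](_ : _ = qprod q q (m + k).+1 * (1 - q * q ^+ m)).
  rewrite [X in _ + X = _](_ : _ = q ^+ m.+1 * qprod q q (m + k).+1 * (1 - q * q ^+ k)).
    by rewrite (qprodS q q (m + k).+1) !exprS exprD; ring.
  by rewrite -e2 (qprodS _ _ k); ring.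
by rewrite -e1 (qprodS _ _ m); ring.
Qed.

(* Common homogeneous form of the q-binomial theorem (C = 0) and of the
   q-Chu-Vandermonde sum (D = 1). *)
Lemma qVandermonde q B C D n :
  \sum_(j < n.+1) qbinom q n j * q ^+ 'C(j, 2)
     * (\prod_(0 <= i < j) (C * q ^+ i - B)) * (\prod_(j <= i < n) (D - C * q ^+ i))
  = \prod_(0 <= i < n) (D - B * q ^+ i).
Proof.
elim: n C => [|n IHn] C.
  by rewrite big_ord1 qbinom0 !big_nil !mulr1.
pose F m C j := q ^+ 'C(j, 2)
     * (\prod_(0 <= i < j) (C * q ^+ i - B)) * (\prod_(j <= i < m) (D - C * q ^+ i)).
have IH C' : \sum_(j < n.+1) qbinom q n j * F n C' j = \prod_(0 <= i < n) (D - B * q ^+ i).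
  by rewrite -(IHn C'); apply: eq_bigr => j _; rewrite /F; ring.
rewrite (eq_bigr (fun j : 'I_n.+2 => qbinom q n.+1 j * F n.+1 C j)); last first.
  by move=> j _; rewrite /F; ring.
rewrite big_ord_recl /=.
under eq_bigr => i _.
  rewrite /bump /= add1n mulrDl.
over.
rewrite big_split /= addrA -[X in X + _ + _](_ : qbinom q n 0 * F n.+1 C 0 = _); last first.
  by rewrite qbinom0.
rewrite -(big_ord_recl _ (fun j : 'I_n.+2 => qbinom q n j * F n.+1 C j)) /=.
rewrite big_ord_recr /= [qbinom q n n.+1]qbinom_small // mul0r addr0.
(* In the first Pascal half each term gains the factor at i = n; the second half is the sum for
   [C * q]. The factors D - C q^n and q^n (C - B) add up to D - B q^n. *)
have -> : \sum_(j < n.+1) qbinom q n j * F n.+1 C j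
   = (D - C * q ^+ n) * \prod_(0 <= i < n) (D - B * q ^+ i).
  rewrite -(IH C) big_distrr; apply: eq_bigr => j _ /=.
  by rewrite /F big_nat_recr ?leq_ord //=; ring.
have -> : \sum_(i < n.+1) q ^+ (n - i) * qbinom q n i * F n.+1 C i.+1
   = q ^+ n * (C - B) * \prod_(0 <= i < n) (D - B * q ^+ i).
  rewrite -(IH (C * q)) big_distrr; apply: eq_bigr => j _ /=.
  rewrite /F big_nat_recl // binS bin1 exprD expr0 mulr1.
  have -> : q ^+ n = q ^+ (n - j) * q ^+ j by rewrite -exprD subnK ?leq_ord.
  rewrite big_add1 /= (eq_bigr (fun i => C * q * q ^+ i - B)); last first.
    by move=> i _; rewrite exprS; ring.
  rewrite (eq_bigr (fun i => D - C * q * q ^+ i) (r := index_iota j n)); last first.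
    by move=> i _; rewrite exprS; ring.
  by ring.
by rewrite big_nat_recr //=; ring.
Qed.

End FiniteProducts.

Arguments qbinom : simpl never.

(** * Bailey pairs relative to a = q *)

Lemma sum_triangle (V : nmodType) (F : nat -> nat -> V) n :
  \sum_(k < n.+1) \sum_(r < k.+1) F k r
  = \sum_(r < n.+1) \sum_(j < (n - r).+1) F (r + j)%N r.
Proof.
rewrite (eq_bigr (fun k : 'I_n.+1 => \sum_(r < n.+1 | (r <= k)%N) F k r)); last first.
  by move=> k _; rewrite (big_ord_widen _ (fun r => F k r) (ltn_ord k)).
rewrite (exchange_big_dep xpredT) //=; apply: eq_bigr => r _.
rewrite -(big_geq_mkord _ _ xpredT (fun k => F k r)) -{1}[val r]add0n big_addn big_mkord.
rewrite subSn ?leq_ord //.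
by apply: eq_bigr => j _; rewrite addnC.
Qed.

(** Pairs indices symmetric about the middle, turning the q-binomial expansion into a one-sided
    theta sum. *)
Lemma sum_fold (V : nmodType) (F : nat -> V) n :
  \sum_(j < n.*2.+2) F j = \sum_(r < n.+1) (F (n - r)%N + F (n + r).+1).
Proof.
rewrite big_split /= -(big_mkord xpredT F) (@big_cat_nat _ _ _ n.+1) //=; last by lia.
congr (_ + _).
  by rewrite big_mkord (reindex_inj rev_ord_inj); apply: eq_bigr => i _; rewrite /= subSS.
rewrite -{1}[n.+1]add0n big_addn big_mkord (_ : n.*2.+2 - n.+1 = n.+1)%N; last by lia.
by apply: eq_bigr => i _; rewrite addnS addnC.
Qed.

(** Free of halving and subtraction, so that [nia] can treat binomial exponents as polynomials. *)
Lemma bin2_sqr n : ('C(n, 2) * 2 + n = n ^ 2)%N.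
Proof. by elim: n => // n IHn; rewrite binS bin1; nia. Qed.

Section BaileyPairs.
Variables (A : comUnitRingType) (q : A).
Hypothesis q_unit : forall n, 1 - q ^+ n.+1 \is a GRing.unit.

Local Notation Q := (qprod q q).

Lemma qfact_unit n : Q n \is a GRing.unit.
Proof.
elim: n => [|n IHn]; first by rewrite qprod0 unitr1.
by rewrite qprodS unitrM IHn -exprS q_unit.
Qed.

Lemma qbinomE n k : (k <= n)%N -> qbinom q n k = Q n / (Q k * Q (n - k)).
Proof.
move=> /subnK <-; apply: canRL (mulrK _) _; first by rewrite unitrM !qfact_unit.
by rewrite addnK mulrA qbinom_qprod.
Qed.

Lemma prod_qfact s j n : (j <= n)%N ->
  \prod_(j <= i < n) (1 - q ^+ s.+1 * q ^+ i) = Q (n + s) / Q (j + s).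
Proof.
move=> /subnK <-; move: (n - j)%N => m; rewrite (addnC m).
elim: m => [|m IHm]; first by rewrite addn0 big_geq // divrr ?qfact_unit.
rewrite addnS big_nat_recr ?leq_addr //= IHm addSn qprodS.
by rewrite mulrAC -exprD -exprS addSn addnC.
Qed.

(** The case C = q^(s+1), D = 1 of [qVandermonde], normalized. With s = 2r+1 it evaluates the inner
    sum of a Bailey step. *)
Lemma qVandermonde_inv s B n :
  \sum_(j < n.+1) q ^+ 'C(j, 2) * (\prod_(0 <= i < j) (q ^+ (s.+1 + i) - B))
     / (Q j * Q (n - j) * Q (j + s))
  = \prod_(0 <= i < n) (1 - B * q ^+ i) / (Q n * Q (n + s)).
Proof.
rewrite -(qVandermonde q B (q ^+ s.+1)) big_distrl; apply: eq_bigr => j _ /=.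
rewrite qbinomE ?prod_qfact ?leq_ord //.
rewrite (eq_bigr (fun i => q ^+ s.+1 * q ^+ i - B) (r := index_iota 0 j)); last first.
  by move=> i _; rewrite exprD.
rewrite !invrM ?unitrM ?qfact_unit //.
have e1 := divrr (qfact_unit n); have e2 := divrr (qfact_unit (n + s)).
by ring: e1 e2.
Qed.

(** At a = q the usual (aq; q)_(n+r) is (q; q)_(n+r+1) / (1 - q); the factor 1 - q is absorbed into
    the first sequence. *)
Definition bailey_pair (a b : nat -> A) :=
  forall n, b n = \sum_(r < n.+1) a r / (Q (n - r) * Q (n + r).+1).

(** Insert the pair, exchange the sums and put k = r + j: the hypothesis sums over j and separates r
    from the final index. *)
Lemma bailey_step (a b w c d : nat -> A) :
  (forall r n, \sum_(j < n.+1) w (r + j)%N / (Q j * Q (n - j) * Q (j + r.*2.+1))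
     = c r * d (r + n)%N / (Q n * Q (n + r.*2.+1))) ->
  bailey_pair a b -> forall n,
  \sum_(k < n.+1) w k * b k / Q (n - k)
  = d n * \sum_(r < n.+1) c r * a r / (Q (n - r) * Q (n + r).+1).
Proof.
move=> wE bE n; pose F k r := w k / Q (n - k) * (a r / (Q (k - r) * Q (k + r).+1)).
rewrite (eq_bigr (fun k : 'I_n.+1 => \sum_(r < k.+1) F k r)); last first.
  by move=> k _; rewrite bE -big_distrr /=; ring.
rewrite sum_triangle big_distrr; apply: eq_bigr => r _ /=.
have := wE r (n - r)%N; rewrite subnKC ?leq_ord //.
have -> : (n - r + r.*2.+1 = (n + r).+1)%N by have := ltn_ord r; lia.
have -> : d n * (c r * a r / (Q (n - r) * Q (n + r).+1))
  = a r * (c r * d n / (Q (n - r) * Q (n + r).+1)) by ring.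
move=> <-; rewrite big_distrr; apply: eq_bigr => j _ /=; rewrite /F.
have -> : (r + j - r = j)%N by lia.
have -> : (r + j + r = j + r.*2)%N by lia.
have -> : (n - (r + j) = n - r - j)%N by lia.
by rewrite addnS !invrM ?unitrM ?qfact_unit //; ring.
Qed.

(** Bailey's lemma with both parameters sent to infinity, which is B = 0 in [qVandermonde_inv]. *)
Lemma bailey_square (a b : nat -> A) : bailey_pair a b ->
  bailey_pair (fun r => q ^+ (r ^ 2 + r) * a r)
    (fun n => \sum_(k < n.+1) q ^+ (k ^ 2 + k) * b k / Q (n - k)).
Proof.
move=> ab n; rewrite /=.
rewrite (@bailey_step a b (fun k => q ^+ (k ^ 2 + k)) (fun r => q ^+ (r ^ 2 + r))
  (fun=> 1)) ?mul1r // => r {}n.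
have := qVandermonde_inv r.*2.+1 0 n.
rewrite [X in X / _](_ : _ = 1); last by apply: big1 => i _; rewrite mul0r subr0.
rewrite mulr1 mul1r => /(congr1 (fun x => q ^+ (r ^ 2 + r) * x)) <-.
rewrite big_distrr; apply: eq_bigr => j _ /=; rewrite mulrA; congr (_ / _).
rewrite (eq_bigr (fun i => q ^+ r.*2.+2 * q ^+ i)); last first.
  by move=> i _; rewrite subr0 exprD.
rewrite big_split /= prodr_const_nat -exprM subn0 prodrXr bin2_sum -!exprD.
by congr (q ^+ _); have := bin2_sqr j; nia.
Qed.

(** Bailey's lemma with one parameter -q and the other sent to infinity, which is B = -q^(r+1). The
    symbols (-q; q)_r cancel in the factor of [a r]. *)
Lemma bailey_binom (a b : nat -> A) : bailey_pair a b -> forall n,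
  \sum_(k < n.+1) q ^+ 'C(k.+1, 2) * qprod (- q) q k * b k / Q (n - k)
  = qprod (- q) q n
    * \sum_(r < n.+1) q ^+ 'C(r.+1, 2) * a r / (Q (n - r) * Q (n + r).+1).
Proof.
move=> ab n.
apply: (@bailey_step a b (fun k => q ^+ 'C(k.+1, 2) * qprod (- q) q k)
  (fun r => q ^+ 'C(r.+1, 2)) (qprod (- q) q)) => // r {}n.
have := qVandermonde_inv r.*2.+1 (- q ^+ r.+1) n.
have E m : qprod (- q) q (r + m)
    = qprod (- q) q r * \prod_(0 <= i < m) (1 - (- q ^+ r.+1) * q ^+ i).
  elim: m => [|m IHm]; first by rewrite addn0 big_geq // mulr1.
  by rewrite addnS qprodS IHm big_nat_recr //= -mulrA !mulNr -exprS -exprD.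
rewrite E => /(congr1 (fun x => q ^+ 'C(r.+1, 2) * qprod (- q) q r * x)).
rewrite !mulrA => <-.
rewrite big_distrr; apply: eq_bigr => j _ /=; rewrite mulrA; congr (_ / _).
(* Here q^(2r+2+i) - B = q^(r+1) (1 + q^(r+1+i)), so the product from [E] reappears. *)
rewrite E [in RHS](eq_bigr (fun i => q ^+ r.+1 * (1 - - q ^+ r.+1 * q ^+ i))
  (r := index_iota 0 j)); last first.
  move=> i _; rewrite (_ : (_ + i = r.+1 + (r.+1 + i))%N); last by lia.
  by rewrite !exprD; ring.
rewrite big_split /= prodr_const_nat -exprM subn0.
have -> : q ^+ 'C((r + j).+1, 2) = q ^+ 'C(r.+1, 2) * q ^+ 'C(j, 2) * q ^+ (r.+1 * j).
  rewrite -!exprD; congr (q ^+ _).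
  by have := (bin2_sqr (r + j).+1, bin2_sqr j, bin2_sqr r.+1); case=> [[]]; nia.
by ring.
Qed.

(** The q-binomial theorem for the product of x q^n - q^i over i < 2n+1. Up to monomials, the
    factors with i <= n give (x; q)_(n+1), and those with i > n give (y; q)_n since q = x y.
    Regularity suffices to cancel the monomial [t], and covers the non-unit series q. *)
Lemma finite_triple_product x y n : GRing.lreg q -> GRing.lreg x -> x * y = q ->
  qprod x q n.+1 * qprod y q n = Q n.*2.+1 *
    \sum_(r < n.+1) (-1) ^+ r * (q ^+ 'C(r, 2) * y ^+ r - q ^+ 'C(r.+1, 2) * x ^+ r.+1)
      / (Q (n - r) * Q (n + r).+1).
Proof.
move=> q_reg x_reg xy; pose t := (-1) ^+ n.+1 * (q ^+ ('C(n.+1, 2) + n ^ 2) * x ^+ n).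
have t_reg : GRing.lreg t.
  by apply: lregM; [exact: lreg_sign | apply: lregM; exact: lregX].
apply: t_reg.
have lowE m : (m <= n.+1)%N -> \prod_(0 <= i < m) (x * q ^+ n - 1 * q ^+ i)
    * \prod_(i < n.+1 - m) (1 - x * q ^+ i) = (-1) ^+ m * q ^+ 'C(m, 2) * qprod x q n.+1.
  elim: m => [|m IHm] mn; first by rewrite big_geq // subn0 !mul1r.
  have := IHm (ltnW mn); rewrite subSS subSn // big_ord_recr big_nat_recr //= binS bin1.
  rewrite exprS exprD => e.
  transitivity (- q ^+ m * ((-1) ^+ m * q ^+ 'C(m, 2) * qprod x q n.+1)); last by ring.
  rewrite -e; have -> : q ^+ n = q ^+ m * q ^+ (n - m) by rewrite -exprD subnKC.
  by ring.
have highE m : \prod_(n.+1 <= i < n.+1 + m) (x * q ^+ n - 1 * q ^+ i)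
    = x ^+ m * q ^+ (n * m) * qprod y q m.
  elim: m => [|m IHm]; first by rewrite addn0 big_geq // muln0 qprod0 !mul1r.
  rewrite addnS big_nat_recr ?leq_addr //= IHm qprodS mulnS addSn exprS exprD exprD -xy.
  by rewrite exprS; ring.
have <- : \prod_(0 <= i < n.*2.+1) (x * q ^+ n - 1 * q ^+ i) = t * (qprod x q n.+1 * qprod y q n).
  rewrite (@big_cat_nat _ _ _ n.+1) //=; last by lia.
  have := lowE n.+1 (leqnn _); rewrite subnn big_ord0 mulr1 => ->.
  rewrite (_ : n.*2.+1 = n.+1 + n)%N; last by lia.
  by rewrite highE /t exprD; ring.
rewrite -(qVandermonde q 1 0).
rewrite (eq_bigr (fun j : 'I_n.*2.+2 => (-1) ^+ j * q ^+ 'C(j, 2) * (x * q ^+ n) ^+ (n.*2.+1 - j)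
    * qbinom q n.*2.+1 j)); last first.
  move=> j _; rewrite (eq_bigr (fun=> -1)) => [|i _]; last by rewrite mul0r sub0r.
  rewrite (eq_bigr (fun=> x * q ^+ n) (r := index_iota j _)) => [|i _]; last by rewrite mul0r subr0.
  by rewrite !prodr_const_nat subn0; ring.
rewrite (sum_fold (fun j => (-1) ^+ j * q ^+ 'C(j, 2) * (x * q ^+ n) ^+ (n.*2.+1 - j)
    * qbinom q n.*2.+1 j)) mulrA [t * _]mulrC -mulrA big_distrr big_distrr.
apply: eq_bigr => r _ /=; have rn : (r <= n)%N := leq_ord r.
rewrite !qbinomE; [|lia..].
rewrite (_ : n.*2.+1 - (n - r) = (n + r).+1)%N; last by lia.
rewrite (_ : n.*2.+1 - (n + r).+1 = n - r)%N; last by lia.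
have eL : q ^+ 'C(n - r, 2) * (x * q ^+ n) ^+ (n + r).+1
    = q ^+ ('C(n.+1, 2) + n ^ 2) * x ^+ n * (q ^+ 'C(r.+1, 2) * x ^+ r.+1).
  rewrite exprMn -exprM -addnS exprD.
  rewrite [LHS](_ : _ = q ^+ ('C(n - r, 2) + n * (n + r.+1)) * (x ^+ n * x ^+ r.+1)).
    rewrite (_ : _ + _ = 'C(n.+1, 2) + n ^ 2 + 'C(r.+1, 2))%N; first by rewrite exprD; ring.
    by have := (bin2_sqr (n - r), bin2_sqr n.+1, bin2_sqr r.+1); case=> [[]]; nia.
  by rewrite exprD; ring.
(* A spare factor q^r = x^r y^r restores x^n and produces y^r. *)
have eR : q ^+ 'C((n + r).+1, 2) * (x * q ^+ n) ^+ (n - r)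
    = q ^+ ('C(n.+1, 2) + n ^ 2) * x ^+ n * (q ^+ 'C(r, 2) * y ^+ r).
  have -> : x ^+ n = x ^+ (n - r) * x ^+ r by rewrite -exprD subnK.
  rewrite exprMn -exprM.
  transitivity (q ^+ ('C((n + r).+1, 2) + n * (n - r)) * x ^+ (n - r)).
    by rewrite exprD; ring.
  rewrite (_ : _ + _ = 'C(n.+1, 2) + n ^ 2 + 'C(r, 2) + r)%N.
    transitivity (q ^+ ('C(n.+1, 2) + n ^ 2) * q ^+ 'C(r, 2) * (x * y) ^+ r * x ^+ (n - r)).
      by rewrite xy !exprD; ring.
    by rewrite exprMn; ring.
  by have := (bin2_sqr (n + r).+1, bin2_sqr n.+1, bin2_sqr r); case=> [[]]; nia.
have sgn : (-1) ^+ (n - r) = (-1) ^+ (n + r) :> A.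
  by rewrite -signr_odd oddB // -oddD signr_odd.
rewrite -(mulrA _ (q ^+ 'C(n - r, 2))) eL -(mulrA _ (q ^+ 'C((n + r).+1, 2))) eR sgn /t.
rewrite [Q (n + r).+1 * _]mulrC !exprS exprD.
by ring.
Qed.

(** The triple product at x = q, y = 1, where (1; q)_n vanishes for n > 0. *)
Lemma bailey_unit : GRing.lreg q ->
  bailey_pair (fun r => (-1) ^+ r * (q ^+ 'C(r, 2) - q ^+ 'C(r.+1, 2) * q ^+ r.+1))
    (fun n => (n == 0%N)%:R).
Proof.
move=> q_reg n; apply: (mulrI (qfact_unit n.*2.+1)).
have := finite_triple_product n q_reg q_reg (mulr1 q).
under [X in _ = _ * X]eq_bigr => i _ do rewrite expr1n mulr1.
move=> <-; case: n => [|n].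
  by rewrite !qprodS !qprod0 !mul1r expr0 mulr1.
rewrite mulr0 [qprod 1 q _]big_ord_recl mul1r expr0 subrr mul0r mulr0.
by [].
Qed.

Lemma qprodN_unit n : qprod (- q) q n \is a GRing.unit.
Proof.
elim: n => [|n IHn]; first by rewrite qprod0 unitr1.
rewrite qprodS unitrM IHn /= mulNr opprK -exprS.
(* A factor of a unit is a unit, and this product is 1 - q^(2n+2). *)
have : (1 - q ^+ n.+1) * (1 + q ^+ n.+1) \is a GRing.unit.
  by rewrite -subr_sqr expr1n -exprM muln2 q_unit.
by rewrite unitrM => /andP[].
Qed.

(** This is g_n, with (q^2; q^2)_k written as (-q; q)_k (q; q)_k. *)
Definition rr_sum n :=
  \sum_(k < n.+1) q ^+ (k ^ 2 + k) / (qprod (- q) q k * Q k) / Q (n - k).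

(* q^((5r^2+3r)/2) (1 - q^(2r+1)) up to sign, in the shape of the terms of the
   triple product in base q^5. *)
Definition rr_theta r : A :=
  (-1) ^+ r * ((q ^+ 5) ^+ 'C(r, 2) * (q ^+ 4) ^+ r - (q ^+ 5) ^+ 'C(r.+1, 2) * q ^+ r.+1).

Lemma rr_finite n : GRing.lreg q ->
  \sum_(k < n.+1) q ^+ 'C(k.+1, 2) * qprod (- q) q k * rr_sum k / Q (n - k)
  = qprod (- q) q n
    * \sum_(r < n.+1) rr_theta r / (Q (n - r) * Q (n + r).+1).
Proof.
move=> q_reg; pose a r := (-1) ^+ r * (q ^+ 'C(r, 2) - q ^+ 'C(r.+1, 2) * q ^+ r.+1).
(* Apply [bailey_binom] to the unit pair: only k = 0 survives on the left, and (-q; q)_n is divided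
   out. *)
have step1 : bailey_pair (fun r => q ^+ 'C(r.+1, 2) * a r)
    (fun n => (qprod (- q) q n * Q n)^-1).
  move=> m; apply: (mulrI (qprodN_unit m)); rewrite -(bailey_binom (bailey_unit q_reg)).
  rewrite big_ord_recl big1 => [|i _]; last by rewrite mulr0 mul0r.
  by rewrite qprod0 expr0 !mul1r subn0 addr0 invrM ?qprodN_unit ?qfact_unit // mulrA mulrAC
    divrr ?qprodN_unit // mul1r.
rewrite (bailey_binom (bailey_square step1)); congr (_ * _).
apply: eq_bigr => r _; congr (_ / _); rewrite /rr_theta /a -!exprM.
transitivity ((-1) ^+ r * (q ^+ ('C(r.+1, 2) + (r ^ 2 + r) + 'C(r.+1, 2) + 'C(r, 2))
  - q ^+ ('C(r.+1, 2) + (r ^ 2 + r) + 'C(r.+1, 2) + 'C(r.+1, 2) + r.+1))).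
  by rewrite !exprD; ring.
rewrite -!exprD; congr (_ * (q ^+ _ - q ^+ _));
  by have := (bin2_sqr r, bin2_sqr r.+1); case; nia.
Qed.

Lemma rr_sum0 : rr_sum 0 = 1.
Proof. by rewrite /rr_sum big_ord1 !qprod0 !mulr1 expr0 !divr1. Qed.

(** [rr_sum] is a Cauchy product of sequences [a] and [b] with first-order recurrences. Write 1 - XY
    = (1 - X) Y + (1 - Y) with X = q^(2k), Y = q^(2(n+1-k)); then [aS] lowers k and [bS] lowers
    n+1-k. *)
Lemma rr_sumS n :
  (1 - q ^+ (2 * n.+1)) * rr_sum n.+1
  = (1 + q + q ^+ (2 * n.+1)) * rr_sum n - q * (if n is m.+1 then rr_sum m else 0).
Proof.
pose a k := q ^+ (k ^ 2 + k) / (qprod (- q) q k * Q k); pose b m := (Q m)^-1.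
have aS k : (1 - q ^+ (2 * k.+1)) * a k.+1 = q ^+ (2 * k.+1) * a k.
  have e : a k = (1 - q ^+ (2 * k.+1)) * (q ^+ (k ^ 2 + k) / (qprod (- q) q k.+1 * Q k.+1)).
    rewrite (_ : 1 - _ = (1 + q * q ^+ k) * (1 - q * q ^+ k)); last first.
      by rewrite mulnC exprM -exprS; ring.
    apply: canLR (mulrK _) _; first by rewrite unitrM qprodN_unit qfact_unit.
    transitivity (q ^+ (k ^ 2 + k) * (qprod (- q) q k.+1 * Q k.+1)
       / (qprod (- q) q k.+1 * Q k.+1)).
      by rewrite mulrK // unitrM qprodN_unit qfact_unit.
    by rewrite !qprodS; ring.
  rewrite e /a (_ : k.+1 ^ 2 + k.+1 = 2 * k.+1 + (k ^ 2 + k))%N; last by lia.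
  by rewrite exprD; ring.
have bS m : (1 - q ^+ m.+1) * b m.+1 = b m.
  rewrite /b qprodS -exprS invrM ?qfact_unit ?q_unit // mulrA divrr ?mul1r //.
have convE m : rr_sum m = \sum_(k < m.+1) a k * b (m - k)%N by [].
have dropE m : \sum_(k < m.+1) (1 - q ^+ (m - k)) * (a k * b (m - k)%N)
    = if m is l.+1 then rr_sum l else 0.
  rewrite big_ord_recr /= subnn expr0 subrr mul0r addr0.
  case: m => [|m]; first by rewrite big_ord0.
  by apply: eq_bigr => k _; rewrite subSn ?leq_ord // mulrCA bS.
rewrite -dropE !convE !big_distrr -sumrB /=.
transitivity (\sum_(k < n.+2) ((1 - q ^+ (2 * k)) * a k * (q ^+ (2 * (n.+1 - k)) * b (n.+1 - k)%N))
  + \sum_(k < n.+2) a k * (1 - q ^+ (2 * (n.+1 - k))) * b (n.+1 - k)%N).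
  rewrite -big_split; apply: eq_bigr => k _ /=.
  have -> : q ^+ (2 * n.+1) = q ^+ (2 * k) * q ^+ (2 * (n.+1 - k)).
    by rewrite -exprD -mulnDr subnKC ?leq_ord.
  by ring.
rewrite big_ord_recl [X in _ + X]big_ord_recr /= subnn expr0 subrr mulr0 !mul0r add0r addr0.
rewrite -big_split; apply: eq_bigr => k _ /=.
rewrite /bump add1n subSS aS subSn ?leq_ord // -bS.
have -> : q ^+ (2 * n.+1) = q ^+ (2 * k.+1) * q ^+ (2 * (n - k)).
  by rewrite -exprD -mulnDr addSn subnKC ?leq_ord.
have -> : q ^+ (2 * (n - k).+1) = q ^+ (n - k).+1 * q ^+ (n - k).+1.
  by rewrite -exprD addnn -mul2n.
by rewrite !exprS; ring.
Qed.

End BaileyPairs.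

(** * Truncation of power series *)

Section Truncation.
Variable R : comNzRingType.
Implicit Types f g a p : fps R.
Local Notation q := (fps_q : fps R).

Lemma fps_coef_sum (I : Type) (s : seq I) (P : pred I) (F : I -> fps R) n :
  (\sum_(i <- s | P i) F i) n = \sum_(i <- s | P i) F i n.
Proof. by apply: (big_morph (fun f : fps R => f n)). Qed.

Lemma fps_coef_qM f n : (q * f) n = if n is m.+1 then f m else 0.
Proof.
rewrite fps_coefM; case: n => [|n]; first by rewrite big_ord1 mul0r.
rewrite !big_ord_recl big1 => [|i _]; last by rewrite mul0r.
by rewrite mul0r mul1r add0r addr0 /= /bump /= subSS subn0.
Qed.

Lemma fps_coef_qnM f k n : (q ^+ k * f) n = if (n < k)%N then 0 else f (n - k)%N.
Proof.
elim: k n => [|k IHk] n; first by rewrite mul1r subn0.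
by rewrite exprS -mulrA fps_coef_qM; case: n => [|n] //; rewrite IHk.
Qed.

Lemma fps_q_lreg : GRing.lreg q.
Proof.
move=> f g fg; apply: fpsP => n.
by have := congr1 (fun h : fps R => h n.+1) fg; rewrite /= !fps_coef_qM.
Qed.

Lemma fps_q_exp0 n : (q ^+ n.+1) 0%N = 0.
Proof. by rewrite exprS fps_coef_qM. Qed.

Definition fps_eqm N f g := forall i, (i < N)%N -> f i = g i.

Lemma fps_eqm_refl N f : fps_eqm N f f. Proof. by []. Qed.

Lemma fps_eqm_sym N f g : fps_eqm N f g -> fps_eqm N g f.
Proof. by move=> fg i iN; rewrite fg. Qed.

Lemma fps_eqm_trans N f g h : fps_eqm N f g -> fps_eqm N g h -> fps_eqm N f h.
Proof. by move=> fg gh i iN; rewrite fg ?gh. Qed.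

Lemma fps_eqm_leq N M f g : (M <= N)%N -> fps_eqm N f g -> fps_eqm M f g.
Proof. by move=> MN fg i iM; rewrite fg // (leq_trans iM). Qed.

Lemma fps_eqmM N f f' g g' :
  fps_eqm N f f' -> fps_eqm N g g' -> fps_eqm N (f * g) (f' * g').
Proof.
move=> ff gg i iN; rewrite !fps_coefM; apply: eq_bigr => j _.
by rewrite ff ?gg // (leq_ltn_trans _ iN) ?leq_subr // -ltnS.
Qed.

Lemma fps_eqm_sum N (I : Type) (s : seq I) (F G : I -> fps R) :
  (forall i, fps_eqm N (F i) (G i)) ->
  fps_eqm N (\sum_(i <- s) F i) (\sum_(i <- s) G i).
Proof.
by move=> FG n nN; rewrite !fps_coef_sum; apply: eq_bigr => i _; apply: FG.
Qed.

Lemma fps_eqm_qn N k f g :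
  fps_eqm (N - k) f g -> fps_eqm N (q ^+ k * f) (q ^+ k * g).
Proof.
move=> fg i iN; rewrite !fps_coef_qnM; case: ltnP => // ki.
by apply: fg; rewrite ltn_sub2r // (leq_ltn_trans ki).
Qed.

Lemma fps_eqmP f g : (forall N, fps_eqm N f g) -> f = g.
Proof. by move=> fg; apply: fpsP => n; apply: (fg n.+1). Qed.

(** As a and p have no constant term, factor i is 1 modulo q^(i+1); N factors thus fix N+1
    coefficients. *)
Lemma qprod_qpoch a p M N : a 0%N = 0 -> p 0%N = 0 -> (M <= N.+1)%N ->
  fps_eqm M (qprod a p N) (qpoch a p).
Proof.
move=> a0 p0 MN i iM; have [N0 N0E] := qpoch_cvg a p0 i.
have stable n : (i <= n)%N -> qprod a p n i = qprod a p i i.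
  elim: n => [|n IHn]; first by rewrite leqn0 => /eqP ->.
  rewrite leq_eqVlt => /predU1P[<- //|]; rewrite ltnS => le; rewrite -(IHn le).
  rewrite qprodS mulrBr mulr1 fps_coefD fps_coefN mulrCA fps_coefM big_ord_recl a0 mul0r add0r.
  rewrite big1 ?subr0 // => j _; rewrite fps_coefM big1 ?mulr0 // => k _.
  rewrite (fps_coef_expr0 p0) ?mulr0 // (leq_ltn_trans (leq_subr _ _)) //.
  by rewrite /= /bump add1n (leq_trans _ le) // ltn_subrL /= (leq_ltn_trans _ (ltn_ord j)).
have iN : (i <= N)%N by rewrite -ltnS (leq_trans iM).
rewrite -(N0E (maxn N0 i)) ?leq_maxl // -[RHS]/(qprod a p _ i).
by rewrite !stable ?leq_maxr.
Qed.

(** Sorts the factors by their index modulo b+1, over complete blocks before the limit. *)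
Lemma qpoch_dissect a p b : a 0%N = 0 -> p 0%N = 0 ->
  qpoch a p = \prod_(i < b.+1) qpoch (a * p ^+ i) (p ^+ b.+1).
Proof.
move=> a0 p0; apply: fps_eqmP => N.
have finE n : qprod a p (n * b.+1) = \prod_(i < b.+1) qprod (a * p ^+ i) (p ^+ b.+1) n.
  elim: n => [|n IHn]; first by rewrite big1 ?qprod0 // => i _; rewrite qprod0.
  under [RHS]eq_bigr => i _ do rewrite qprodS.
  rewrite big_split -IHn /= /qprod -!(big_mkord xpredT (fun i => 1 - a * p ^+ i)).
  rewrite (@big_cat_nat _ _ _ (n * b.+1)%N) //=; last by rewrite leq_mul2r leqnSn orbT.
  congr (_ * _); rewrite -{1}[(n * b.+1)%N]add0n big_addn mulSn addnK big_mkord.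
  by apply: eq_bigr => i _; rewrite -mulrA -exprM -exprD mulnC.
apply: fps_eqm_trans (fps_eqm_sym (qprod_qpoch (N := N * b.+1) a0 p0 _)) _.
  by rewrite ltnW // ltnS leq_pmulr.
rewrite finE; elim/big_rec2: _ => // i f g _ fg; apply: fps_eqmM fg.
apply: qprod_qpoch => //; first by rewrite fps_coefM big_ord1 a0 mul0r.
by rewrite (fps_coef_expr0 p0).
Qed.

Lemma qpochN p : p 0%N = 0 -> qpoch p p * qpoch (- p) p = qpoch (p ^+ 2) (p ^+ 2).
Proof.
move=> p0; have p20 : (p ^+ 2) 0%N = 0 by rewrite (fps_coef_expr0 p0).
apply: fps_eqmP => N; have N1 := leqnSn N.
have n0 : (- p) 0%N = 0 by rewrite fps_coefN p0 oppr0.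
apply: fps_eqm_trans (qprod_qpoch p20 p20 N1).
apply: fps_eqm_sym.
rewrite (_ : qprod _ _ _ = qprod p p N * qprod (- p) p N).
  by apply: fps_eqmM; apply: qprod_qpoch.
rewrite /qprod -big_split; apply: eq_bigr => i _ /=.
by rewrite -!exprS -exprM mulNr -exprS mulnC exprM; ring.
Qed.

End Truncation.

(** * The product formula in the limit *)

Section ProductFormula.
Variable R : comUnitRingType.
Local Notation q := (fps_q : fps R).

Lemma fps_q_unit (p : fps R) n : p 0%N = 0 -> 1 - p ^+ n.+1 \is a GRing.unit.
Proof.
move=> p0; rewrite fps_unitE fps_coefD fps_coefN (fps_coef_expr0 p0) // subr0.
by rewrite fps_coef1 unitr1.
Qed.

(** [qprod p p (N - r)] agrees with its limit only modulo q^(N-r+1); the factor q^r makes up for the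
    loss. *)
Lemma qpoch_sum_limit (p : fps R) (t : nat -> fps R) N : p 0%N = 0 ->
  fps_eqm N.+1
    (qpoch p p ^+ 2
      * \sum_(r < N.+1) q ^+ r * t r / (qprod p p (N - r) * qprod p p (N + r).+1))
    (\sum_(r < N.+1) q ^+ r * t r).
Proof.
move=> p0; rewrite big_distrr; apply: fps_eqm_sum => r /=.
set Q := qprod p p; have Qu n : Q n \is a GRing.unit.
  by apply: qfact_unit => m; apply: fps_q_unit.
have -> : qpoch p p ^+ 2 * (q ^+ r * t r / (Q (N - r)%N * Q (N + r).+1))
  = q ^+ r * (t r * (qpoch p p ^+ 2 / (Q (N - r)%N * Q (N + r).+1))) by ring.
apply: fps_eqm_qn; rewrite -[X in fps_eqm _ _ X]mulr1; apply: fps_eqmM; first exact: fps_eqm_refl.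
have QQ : Q (N - r)%N * Q (N + r).+1 \is a GRing.unit by rewrite unitrM !Qu.
rewrite -(divrr QQ) expr2; apply: fps_eqmM; last exact: fps_eqm_refl.
by apply: fps_eqmM; apply: fps_eqm_sym; apply: qprod_qpoch => //; have := ltn_ord r; lia.
Qed.

Lemma rr_product (Y : fps R) :
  (forall N, fps_eqm N.+1 Y
     (\sum_(k < N.+1) q ^+ 'C(k.+1, 2) * qprod (- q) q k * rr_sum q k)) ->
  Y * (qpochs [:: q] (q ^+ 2) * qpochs [:: q ^+ 2; q ^+ 3] (q ^+ 5)) = 1.
Proof.
move=> YE; have q0 : q 0%N = 0 by [].
have Nq0 : (- q) 0%N = 0 by rewrite fps_coefN q0 oppr0.
have qu n : 1 - q ^+ n.+1 \is a GRing.unit by apply: fps_q_unit.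
have q50 : (q ^+ 5) 0%N = 0 := fps_q_exp0 R 4.
have q5u n : 1 - (q ^+ 5) ^+ n.+1 \is a GRing.unit by apply: fps_q_unit.
pose P := q ^+ 5.
have q5r : GRing.lreg P by apply: lregX; apply: fps_q_lreg.
(* [rr_theta] without the factor q^r that [qpoch_sum_limit] requires. *)
pose t r := (-1) ^+ r * (q ^+ (5 * 'C(r, 2) + 3 * r) - q ^+ (5 * 'C(r.+1, 2) + 1)).
have tE r : rr_theta q r = q ^+ r * t r.
  transitivity ((-1) ^+ r * (q ^+ (5 * 'C(r, 2) + 3 * r + r) - q ^+ (5 * 'C(r.+1, 2) + 1 + r))).
    by rewrite /rr_theta -!exprM -!exprD; congr (_ * (q ^+ _ - q ^+ _)); lia.
  by rewrite /t !exprD; ring.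
(* Both sides are compared through the truncated theta sum [T]: [left] is the limit of [rr_finite],
   [right] that of the triple product in base q^5 with x = q, y = q^4. *)
have main : Y * qpoch q q * qpoch P P
    = qpoch (- q) q * (qpoch P P ^+ 2 * (qpoch q P * qpoch (q ^+ 4) P)).
  apply: fps_eqmP => N; apply: (@fps_eqm_leq _ N.+1) => //.
  pose T := \sum_(r < N.+1) q ^+ r * t r.
  have left : fps_eqm N.+1 (Y * qpoch q q) (qpoch (- q) q * T).
    apply: fps_eqm_trans (fps_eqmM (YE N) (fps_eqm_refl _)) _.
    apply: (@fps_eqm_trans _ _ _ (qpoch q q ^+ 2 * (\sum_(k < N.+1)
        q ^+ 'C(k.+1, 2) * qprod (- q) q k * rr_sum q k / qprod q q (N - k)))).
      rewrite expr2 -mulrA mulrC; apply: fps_eqmM; first exact: fps_eqm_refl.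
      rewrite big_distrr; apply: fps_eqm_sum => k /=.
      have -> (a b c d e : fps R) : a * (b * c * d / e) = b * (c * d * (a / e)) by ring.
      (* Since C(k+1,2) >= k, the remaining precision is at most N-k+1, which N-k factors
         provide. *)
      rewrite -mulrA; apply: fps_eqm_qn.
      rewrite -[X in fps_eqm _ X]mulr1; apply: fps_eqmM; first exact: fps_eqm_refl.
      rewrite -(divrr (qfact_unit qu (N - k))); apply: fps_eqmM; last exact: fps_eqm_refl.
      apply: qprod_qpoch => //; rewrite binS bin1; have := ltn_ord k; lia.
    rewrite (rr_finite qu _ (@fps_q_lreg R)) mulrCA.
    apply: fps_eqmM; first by apply: qprod_qpoch.
    under eq_bigr => r _ do rewrite tE.
    exact: qpoch_sum_limit.
  have right : fps_eqm N.+1 (qpoch P P * T) (qpoch P P ^+ 2 * (qpoch q P * qpoch (q ^+ 4) P)).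
    have e := finite_triple_product q5u N q5r (@fps_q_lreg R) (esym (exprS q 4)).
    apply: (@fps_eqm_trans _ _ _ (qpoch P P ^+ 2 * (qprod q P N.+1 * qprod (q ^+ 4) P N))).
      rewrite e mulrCA; apply: fps_eqmM.
        by apply: fps_eqm_sym; apply: qprod_qpoch => //; lia.
      apply: fps_eqm_sym.
      rewrite (eq_bigr (fun r : 'I_N.+1 =>
        q ^+ r * t r / (qprod P P (N - r) * qprod P P (N + r).+1))).
        exact: qpoch_sum_limit.
      by move=> r _; rewrite -tE.
    apply: fps_eqmM; first exact: fps_eqm_refl.
    apply: fps_eqmM; apply: qprod_qpoch => //.
    exact: fps_q_exp0.
  apply: fps_eqm_trans (fps_eqmM left (fps_eqm_refl _)) _.
  rewrite -mulrA [T * _]mulrC; apply: fps_eqmM right; exact: fps_eqm_refl.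
have split5 : qpoch q q = qpoch q P * qpoch (q ^+ 2) P * qpoch (q ^+ 3) P
    * qpoch (q ^+ 4) P * qpoch P P.
  rewrite (qpoch_dissect 4 q0 q0) !big_ord_recr big_ord0 /= mul1r expr0 mulr1.
  by rewrite -!exprS.
have split2 : qpoch q q = qpoch q (q ^+ 2) * qpoch (q ^+ 2) (q ^+ 2).
  by rewrite (qpoch_dissect 1 q0 q0) !big_ord_recr big_ord0 /= mul1r expr0 mulr1 -exprS.
have uq : qpoch q q \is a GRing.unit by apply: qpoch_unit.
have uP : qpoch P P \is a GRing.unit by apply: qpoch_unit.
rewrite /qpochs !big_cons !big_nil !mulr1.
apply: (mulrI uq); apply: (mulrI uq); apply: (mulrI uP).
transitivity ((Y * qpoch q q * qpoch P P) * qpoch q q * qpoch q (q ^+ 2)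
   * (qpoch (q ^+ 2) P * qpoch (q ^+ 3) P)); first by rewrite /P; ring.
rewrite main mulr1.
transitivity ((qpoch q P * qpoch (q ^+ 2) P * qpoch (q ^+ 3) P * qpoch (q ^+ 4) P * qpoch P P)
   * (qpoch q q * qpoch (- q) q) * qpoch q (q ^+ 2) * qpoch P P); first by ring.
rewrite -split5 (qpochN q0) -2!mulrA [RHS]mulrC -mulrA; congr (_ * _).
by rewrite mulrA [_ * qpoch q _]mulrC -split2 mulrC.
Qed.

End ProductFormula.

(** * Partitions of Gamma as chains *)

(** For each pair of colors the forbidden differences are exactly those from 1 to [gap c d - 1], see
    [forbiddenE]. *)
Definition gap (c d : color) : nat :=
  match c, d with
  | Blue, Blue => 1
  | Blue, _ => 2
  | _, Red => 3
  | _, Green => 1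
  | _, Blue => 2
  end.

Definition below : rel part := fun x y => (x.1 + gap x.2 y.2 <= y.1)%N.

Lemma gap_gt0 c d : (0 < gap c d)%N.
Proof. by case: c d => [] []. Qed.

Lemma forbiddenE c k d : ((c, k, d) \in forbidden) = (0 < k < gap c d)%N.
Proof. by case: c d k => [] [] [|[|[|k]]]. Qed.

Lemma below_ltn x y : below x y -> (x.1 < y.1)%N.
Proof. by apply: leq_trans; rewrite -addn1 leq_add2l gap_gt0. Qed.

(** By the triangle inequality for [gap]; hence conditions on neighbours imply those on all
    pairs. *)
Lemma below_trans : transitive below.
Proof.
move=> [y d] [x c] [z e]; rewrite /below /= => xy yz.
have : (gap c e <= gap c d + gap d e)%N by case: c d e {xy yz} => [] [] [].
lia.
Qed.

Lemma below_irr : irreflexive below.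
Proof. by move=> x; apply/negP => /below_ltn; rewrite ltnn. Qed.

Lemma Gamma_below (p : {mset part}) x y : in_Gamma p -> x \in p -> y \in p ->
  x != y -> (x.1 <= y.1)%N -> below x y.
Proof.
case: x y => [i c] [j d] [pos dist forb] xp yp xy /= ij; rewrite /below /=.
have i0 : (0 < i)%N := pos _ xp; move: ij; rewrite leq_eqVlt => /predU1P[ij|ij].
  have := dist i i0; move: xp yp; rewrite !in_mset -ij.
  have {xy} : c != d by apply: contraNneq xy => ->; rewrite ij.
  by case: c d => [] [] //=; lia.
rewrite leqNgt; apply/negP => lt.
apply: (forb i c (j - i)%N d i0); first by rewrite forbiddenE; lia.
by rewrite subnKC // ltnW.
Qed.

Lemma weight_seq_mset (s : seq part) : weight (seq_mset s) = (\sum_(x <- s) x.1)%N.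
Proof. exact/perm_big/perm_eq_seq_mset. Qed.

Lemma mem_seq_mset (s : seq part) x : (x \in seq_mset s) = (x \in s).
Proof. exact/perm_mem/perm_eq_seq_mset. Qed.

(* Forbidding 1_R, 2_R and 1_B amounts to adding a fictitious smallest part 0_R. *)
Lemma Astar_set_path n (s : seq part) : path below (0%N, Red) s ->
  (\sum_(x <- s) x.1 = n)%N -> Astar_set n (seq_mset s).
Proof.
move=> ps ws; have := order_path_min below_trans ps => /allP s0.
have := ps; rewrite (path_pairwise below_trans) => /= /andP[_ pw].
split; rewrite ?mem_seq_mset ?weight_seq_mset //; try by apply/negP => /s0.
split=> [x|j j0|j c k d j0].
- by rewrite mem_seq_mset => /s0 /below_ltn.
- rewrite !mset_seqE.
  (* The three multiplicities count the size j in the strictly increasing list of sizes. *)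
  have -> : (count_mem (j, Red) s + count_mem (j, Green) s + count_mem (j, Blue) s
      = count_mem j (map fst s))%N.
    elim: s {ps ws s0 pw} => //= -[i c] s /= <-; rewrite !xpair_eqE.
    by case: (i == j); case: c => /=; lia.
  rewrite count_uniq_mem; first by case: (_ \in _).
  apply: (sorted_uniq ltn_trans ltnn); rewrite sorted_map.
  by apply: sub_sorted (path_sorted ps) => x y; apply: below_ltn.
rewrite forbiddenE => kcd; rewrite !mem_seq_mset => -[xs ys].
suff [/(congr1 fst)|[]] : (j, c) = (j + k, d)%N \/
    below (j, c) (j + k, d)%N \/ below (j + k, d)%N (j, c).
- by move=> /=; lia.
- by rewrite /below /=; lia.
- by rewrite /below /=; have := gap_gt0 d c; lia.
elim: s pw xs ys {ps ws s0} => //= z s IHs /andP[/allP zs pw].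
rewrite !inE => /predU1P[xz|xs] /predU1P[yz|ys].
- by left; rewrite xz.
- by right; left; rewrite xz; apply: zs.
- by right; right; rewrite yz; apply: zs.
- exact: IHs.
Qed.

(** Sorting by size alone suffices, because the sizes are distinct. *)
Lemma Astar_setP n (p : {mset part}) : Astar_set n p ->
  exists s : seq part, [/\ path below (0%N, Red) s, (\sum_(x <- s) x.1 = n)%N
    & p = seq_mset s].
Proof.
case=> Gp wp R1 R2 B1; pose s : seq part := sort (relpre fst leq) p.
have sp : perm_eq s p by rewrite perm_sort.
have sE : p = seq_mset s by apply/esym; rewrite -[RHS]seq_mset_id; apply/eq_seq_msetP.
exists s; split=> //; last by rewrite -weight_seq_mset -sE.
rewrite (path_pairwise below_trans) /=; apply/andP; split.
  apply/allP => -[j c]; rewrite (perm_mem sp) => jp.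
  have [/(_ _ jp) /= j0 _ _] := Gp; rewrite /below /=.
  by case: c jp; case: j j0 => [|[|[|j]]] //= _ jp; move: R1 R2 B1; rewrite jp.
apply: (@sub_in_pairwise _ (mem p) [rel x y | (x != y) && (x.1 <= y.1)%N]).
- by move=> x y xp yp /= /andP[]; exact: (Gamma_below Gp xp yp).
- by apply/allP => x; rewrite (perm_mem sp).
rewrite (pairwise_relI (fun x y => x != y) (fun x y => x.1 <= y.1)%N) -uniq_pairwise.
rewrite sort_uniq -(sorted_pairwise (leT := relpre fst leq)); last first.
  by move=> y x z; apply: leq_trans.
rewrite sort_sorted ?andbT; last by move=> x y; apply: leq_total.
apply: count_mem_uniq => -[j c]; rewrite count_mem_mset.
have [|np] := boolP ((j, c) \in p); last by apply/eqP; rewrite mset_eq0.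
move=> jp; have [pos dist _] := Gp; have := dist j (pos _ jp).
by move: jp; rewrite in_mset; case: c => /=; lia.
Qed.

(* Includes the size 0, which [below] rules out. *)
Definition parts_upto (w : nat) : seq part :=
  [seq (k, c) | c <- [:: Red; Green; Blue], k <- iota 0 w.+1].

(** The difference [w - y.1] never truncates, as [parts_upto w] bounds [y.1]. *)
Fixpoint chains (n : nat) (x : part) (w : nat) : seq (seq part) :=
  if n is m.+1 then
    [seq y :: s | y <- [seq y <- parts_upto w | below x y], s <- chains m y (w - y.1)]
  else if w == 0%N then [:: [::]] else [::].

Lemma mem_parts_upto w (y : part) : (y \in parts_upto w) = (y.1 <= w)%N.
Proof.
case: y => k c; apply/allpairsPdep/idP => [[d [l [_ + [-> _]]]]|kw].
  by rewrite mem_iota.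
by exists c, k; split=> //; [case: {kw} c | rewrite mem_iota].
Qed.

Lemma mem_chains n x w s : (s \in chains n x w)
  = [&& size s == n, path below x s & (\sum_(y <- s) y.1 == w)%N].
Proof.
elim: n x w s => [|n IHn] x w s.
  rewrite /=; case: s => [|y s] /=; last by case: eqP.
  by rewrite big_nil eq_sym; case: eqP.
apply/allpairsPdep/idP => [[y [t [+ + ->]]]|].
  rewrite mem_filter mem_parts_upto IHn /= big_cons => /andP[-> yw] /and3P[/eqP-> -> /eqP ->].
  by rewrite eqxx /= subnKC.
case: s => [|y s]; first by [].
move=> /and3P[sn /andP[xy ys]]; rewrite big_cons => /eqP sw.
exists y, s; split; [|rewrite IHn|by []].
  by rewrite mem_filter xy mem_parts_upto -sw leq_addr.
by rewrite [path _ _ _]ys -sw addKn eqxx -eqSS [_ == _]sn.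
Qed.

Lemma uniq_chains n x w : uniq (chains n x w).
Proof.
elim: n x w => [|n IHn] x w; first by rewrite /=; case: eqP.
apply: allpairs_uniq_dep => [|y _|[y s] [z t] _ _ /= [-> ->]].
- apply: filter_uniq; apply: allpairs_uniq; rewrite ?iota_uniq // => -[? ?] [? ?] _ _ /= [-> ->].
  by [].
- exact: IHn.
- by [].
Qed.

Lemma AstarE n : Astar n = (\sum_(i < n.+1) size (chains i (0%N, Red) n))%N.
Proof.
pose L := flatten [seq chains i (0%N, Red) n | i <- iota 0 n.+1].
have LP s : reflect (path below (0%N, Red) s /\ (\sum_(x <- s) x.1 = n)%N) (s \in L).
  apply: (iffP flatten_mapP) => [[i _]|[ps ws]].
    by rewrite mem_chains => /and3P[_ -> /eqP].
  (* All parts are positive, so there are at most n of them. *)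
  exists (size s); last by rewrite mem_chains eqxx ps ws /=.
  rewrite mem_iota /= add0n ltnS -ws -sum1_size big_seq [leqRHS]big_seq.
  apply: leq_sum => x xs.
  by have /allP /(_ _ xs) /below_ltn := order_path_min below_trans ps.
have uL : uniq L.
  rewrite /L; elim: (iota 0 n.+1) (iota_uniq 0 n.+1) => //= i l IHl /andP[il ul].
  rewrite cat_uniq uniq_chains IHl // andbT; apply/hasPn => s /flatten_mapP[j jl].
  rewrite mem_chains => /and3P[/eqP sj _ _]; apply/negP.
  by rewrite mem_chains sj => /and3P[/eqP ji _ _]; rewrite -ji jl in il.
(* [below] is a strict order, so a multiset has at most one arrangement as a chain. *)
have injL : {in L &, injective (@seq_mset part)}.
  move=> s t /LP[ps _] /LP[pt _] /eq_seq_msetP st.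
  apply: (irr_sorted_eq below_trans below_irr) (path_sorted ps) (path_sorted pt) _.
  exact: perm_mem.
have -> : (\sum_(i < n.+1) size (chains i (0%N, Red) n) = size L)%N.
  rewrite /L size_flatten /shape -map_comp sumnE big_map.
  by rewrite -(big_mkord xpredT (fun i => size (chains i _ n))) /index_iota subn0.
rewrite -(size_map (@seq_mset part)) /Astar.
have -> : fset_set (Astar_set n) = [fset p in map (@seq_mset part) L]%fset.
  apply/fsetP => p; rewrite in_fset_set; last exact: finite_Astar_set.
  rewrite !inE; apply/idP/mapP => [|[s /LP[ps ws] ->]].
    by rewrite in_setE => /Astar_setP[s [ps ws ->]]; exists s => //; apply/LP.
  by rewrite in_setE; apply: Astar_set_path.
by rewrite card_fseq undup_id // map_inj_in_uniq.
Qed.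

(** * Generating functions of chains *)

Local Notation q := (fps_q : fps int).
Local Notation Q := (qprod q q).

(** A geometric series by telescoping; as t > 0, terms with k > w do not reach coefficient w. *)
Lemma geometric_coef (R : comUnitRingType) (f : fps R) t a w : (0 < t)%N ->
  \sum_(k < w.+1 | (a <= k)%N) ((fps_q ^+ (t * k) * f) w)
  = (fps_q ^+ (t * a) * f / (1 - fps_q ^+ t)) w.
Proof.
move=> t0; pose h := f / (1 - fps_q ^+ t); pose u k := (fps_q ^+ (t * k) * h) w.
have ut : 1 - fps_q ^+ t \is a @GRing.unit (fps R).
  by case: t t0 {h u} => // t _; apply: fps_q_unit.
have uw k : (w < t * k)%N -> u k = 0 by rewrite /u fps_coef_qnM => ->.
rewrite -mulrA -[RHS]/(u a).
rewrite -(big_geq_mkord a w.+1 xpredT (fun k => (fps_q ^+ (t * k) * f) w)).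
have [aw|wa] := leqP a w.+1; last first.
  rewrite big_geq ?(ltnW wa) // uw //; nia.
transitivity (\sum_(a <= k < w.+1) - (u k.+1 - u k)).
  apply: eq_bigr => k _; rewrite opprB /u.
  have -> : f = h * (1 - fps_q ^+ t) by rewrite divrK.
  rewrite (_ : fps_q ^+ _ * _ = fps_q ^+ (t * k) * h + - (fps_q ^+ (t * k.+1) * h)).
    by rewrite fps_coefD fps_coefN.
  by rewrite mulnS exprD; ring.
by rewrite sumrN telescope_sumr // (uw w.+1) ?sub0r ?opprK //; nia.
Qed.

(* The first component serves both Red and Green, which have the same gaps to
   the next part. *)
Fixpoint chain_num (n : nat) : fps int * fps int :=
  if n is m.+1 then
    let: (r, s) := chain_num m in
    ((1 + q ^+ (2 * n)) * r + q ^+ n * s, 2 * q ^+ n * r + s)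
  else (1, 1).

(* Chains of n parts above a fictitious part 0_c. *)
Definition chain_gf n c : fps int :=
  q ^+ 'C(n.+1, 2) * (if c is Blue then (chain_num n).2 else (chain_num n).1) / Q n.

Lemma q_unit n : 1 - q ^+ n.+1 \is a GRing.unit.
Proof. exact: fps_q_unit. Qed.

(** The lowest part, of color d, is at least [gap c d]; raising all n+1 parts together gives 1 / (1
    - q^(n+1)). *)
Lemma chain_gfS n c :
  chain_gf n.+1 c
  = \sum_(d <- [:: Red; Green; Blue]) q ^+ (n.+1 * gap c d) * chain_gf n d / (1 - q ^+ n.+1).
Proof.
rewrite !big_cons big_nil addr0 /chain_gf binS bin1 exprD qprodS -exprS.
rewrite invrM ?(qfact_unit q_unit) ?q_unit //=; case: (chain_num n) => r s /=.
rewrite !(mulnC n.+1) !exprM.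
by case: c => /=; rewrite ?expr1 -?exprM ?(mulnC _ n.+1) ?exprM; ring.
Qed.

(** Gaps are invariant under translation: starting at j instead of 0 raises each of the n parts by
    j. *)
Lemma size_chains n j c w :
  (size (chains n (j, c) w))%:Z = (q ^+ (n * j) * chain_gf n c) w.
Proof.
elim: n j c w => [|n IHn] j c w.
  rewrite mul0n /chain_gf qprod0 divr1 mul1r expr0 mul1r [if c is Blue then _ else _](_ : _ = 1).
    by rewrite fps_coef1 /=; case: eqP.
  by case: c.
rewrite chain_gfS big_distrr fps_coef_sum [size _]size_allpairs_dep.
rewrite sumnE big_map big_filter big_mkcond /parts_upto big_allpairs_dep.
rewrite (big_morph Posz PoszD (erefl 0%:Z)); apply: eq_bigr => d _.
(* A lowest part k contributes q^k itself and q^(nk) through the n parts above it. *)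
transitivity (\sum_(k < w.+1 | (j + gap c d <= k)%N) (q ^+ (n.+1 * k) * chain_gf n d) w).
  rewrite (big_morph Posz PoszD (erefl 0%:Z)) -[iota 0 w.+1]/(index_iota 0 w.+1) big_mkord.
  rewrite [RHS]big_mkcond; apply: eq_bigr => k _; rewrite /below /=.
  case: ifP => // _; rewrite IHn mulSn exprD -mulrA [RHS]fps_coef_qnM ltnNge leq_ord.
  by [].
by rewrite geometric_coef // mulnDr exprD /= !mulrA.
Qed.

Lemma chain_gf_rr n : chain_gf n Red = q ^+ 'C(n.+1, 2) * qprod (- q) q n * rr_sum q n.
Proof.
suff -> : chain_gf n Red = q ^+ 'C(n.+1, 2) * (Q n * qprod (- q) q n * rr_sum q n) / Q n.
  by apply: canLR (mulrK (qfact_unit q_unit n)) _; ring.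
rewrite /chain_gf; congr (_ * _ / _).
(* Eliminating the second component leaves a second-order recurrence, to be matched with [rr_sumS];
   hence the induction carries two consecutive values. *)
have rec m : (chain_num m.+2).1 = (1 + q + q ^+ (2 * m.+2)) * (chain_num m.+1).1
    - q * (1 - q ^+ (2 * m.+1)) * (chain_num m).1.
  rewrite /=; case: (chain_num m) => r s /=.
  by rewrite !mul2n -!addnn !exprD !exprS; ring.
have fact m : Q m.+1 * qprod (- q) q m.+1 = (1 - q ^+ (2 * m.+1)) * (Q m * qprod (- q) q m).
  by rewrite !qprodS mul2n -addnn exprD !exprS; ring.
suff : (chain_num n).1 = Q n * qprod (- q) q n * rr_sum q n
    /\ (chain_num n.+1).1 = Q n.+1 * qprod (- q) q n.+1 * rr_sum q n.+1 by case.
elim: n => [|n [IH1 IH2]].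
  split; first by rewrite !qprod0 rr_sum0 !mulr1.
  rewrite fact !qprod0 !mulr1 (rr_sumS q_unit) rr_sum0 /= muln1; ring.
split=> //; rewrite rec IH1 IH2 (fact n.+1) [RHS]mulrAC (rr_sumS q_unit) (fact n).
ring.
Qed.

Theorem theorem2 :
  gen_series Astar =
  1 / (qpochs [:: fps_q] (fps_q ^+ 2)
       * qpochs [:: fps_q ^+ 2; fps_q ^+ 3] (fps_q ^+ 5)).
Proof.
apply: (canRL (mulrK _)).
  rewrite /qpochs !big_cons !big_nil !mulr1 !unitrM.
  by rewrite !qpoch_unit ?fps_q_exp0.
apply: rr_product => N w wN.
rewrite fps_coef_sum /= AstarE (big_morph Posz PoszD (erefl 0%:Z)).
under eq_bigr => i _ do rewrite size_chains muln0 mul1r chain_gf_rr.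
(* The terms with i > w vanish at w because C(i+1,2) >= i. *)
rewrite (big_ord_widen N.+1 (fun i => (q ^+ 'C(i.+1, 2) * qprod (- q) q i * rr_sum q i) w)) //.
rewrite big_mkcond; apply: eq_bigr => i _; case: ltnP => // wi.
rewrite -mulrA fps_coef_qnM ifT // binS bin1; lia.
Qed.
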